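(* Let $\{S_i\}_{i=1}^m$ be an IFS of similitudes $S_i(x)=rR_ix+d_i$ on $\mathbb R^d$ with common ratio $r\in(0,1)$, and let $(X,\mathcal E)$, $\mathcal E=\mathcal E_v\cup\mathcal E_h$, be its augmented tree with respect to a bounded closed invariant set $J$. Suppose $(X,\mathcal E)$ is simple, with connected classes $\mathscr T_1,\dots,\mathscr T_\kappa$ and incidence matrix $A$, and let $\mathbf b=[b_1,\dots,b_\kappa]^t$, where $b_i=\#T$ for $[T]=\mathscr T_i$. If $A$ is primitive (i.e. $A^n>0$ entrywise for some $n>0$), then $A^k$ is $(m^k,\mathbf b)$-rearrangeable for some $k>0$. Consequently $\partial(X,\mathcal E)\simeq\partial(X,\mathcal E_v)$.
   Context: IFS: $S_i(x)=rR_ix+d_i$, $0<r<1$, $R_i$ orthogonal, $d_i\in\mathbb R^d$. $\Sigma=\{1,\dots,m\}$, $X=\bigcup_{n\ge0}\Sigma^n$, $\Sigma^0=\{o\}$ (empty word, root); $S_{\mathbf u}=S_{i_1}\circ\cdots\circ S_{i_n}$ for $\mathbf u=i_1\cdots i_n$. Augmented tree: $J\subset\mathbb R^d$ is a fixed nonempty bounded closed set with $S_i(J)\subset J$ for all $i$; $J_{\mathbf u}=S_{\mathbf u}(J)$. $\mathcal E_v$: (vertical) edges joining $\mathbf u$ and $\mathbf ui$. $\mathcal E_h$ (horizontal edges): pairs $(\mathbf u,\mathbf v)$, $\mathbf u\ne\mathbf v$ in the same level $\Sigma^n$, with $J_{\mathbf u}\cap J_{\mathbf v}\ne\emptyset$.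 Hyperbolicity: for a connected graph with root $o$ and graph distance $d(\cdot,\cdot)$, put $|x|=d(o,x)$, $|x\wedge y|=\frac12(|x|+|y|-d(x,y))$. The graph is hyperbolic if for some $\delta>0$, $|x\wedge y|\ge\min\{|x\wedge z|,|z\wedge y|\}-\delta$ for all $x,y,z$. For fixed $a>0$ with $e^{\delta a}-1<\sqrt2-1$, put $\rho_a(x,y)=e^{-a|x\wedge y|}$ if $x\ne y$ and $0$ if $x=y$; it is comparable up to multiplicative constants to the metric $\theta_a(x,y)=\inf\{\sum_{i=1}^n\rho_a(x_{i-1},x_i):n\ge1,\ x_0=x,\ x_n=y\}$. The hyperbolic boundary is $\partial X=\hat X\setminus X$, $\hat X$ the completion under $\rho_a$ (equivalently $\theta_a$), with $\rho_a$ extended to it. The same $a$ is used for both graphs. A simple augmented tree is hyperbolic. Simple: a horizontal connected component is a maximal connected horizontal subgraph $T$ of some level $\Sigma^n$. $T\Sigma=\{\mathbf ui:\mathbf u\in T,i\in\Sigma\}$. $T\sim T'$ if there is a bijection $g:T\cup T\Sigma\to T'\cup T'\Sigma$ (as subgraphs of $X$) such that $g,g^{-1}$ preserve vertical and horizontal edges; the class $[T]$ is called a connected class. $X$ is simple if there are finitely many connected classes. Incidence matrix: $A=[a_{ij}]$, where, for any component $T$ with $[T]=\mathscr T_i$, $a_{ij}$ is the number of horizontal connected components $Z$ of $T\Sigma$ with $[Z]=\mathscr T_j$ (this number being independent of the choice of $T$ in the class). Rearrangeable: for $M\in\mathbb N$, a row vector $\mathbf a\in\mathbb Z_{\ge0}^\kappa$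 is $(M,\mathbf b)$-rearrangeable ($\mathbf b$ a column vector with positive integer entries) if there are an integer $p>0$ and a nonnegative integral $p\times\kappa$ matrix $C$ with $\mathbf a=[1,\dots,1]C$ and $C\mathbf b=[M,\dots,M]^t$. A matrix is $(M,\mathbf b)$-rearrangeable if each of its rows is. $\simeq$ (Lipschitz equivalence): existence of a bijection $\sigma$ and $C>0$ with $C^{-1}d(x,y)\le d(\sigma(x),\sigma(y))\le Cd(x,y)$ for all $x,y$. *)

(* Defs.v *)
From HB Require Import structures.
From mathcomp Require Import all_boot all_order all_algebra finmap.
From mathcomp Require Import all_classical all_reals all_analysis.

Set Implicit Arguments.
Unset Strict Implicit.
Unset Printing Implicit Defensive.

Import Order.TTheory GRing.Theory Num.Theory.
Import numFieldNormedType.Exports.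

Local Open Scope classical_set_scope.
Local Open Scope ring_scope.

Section Graph.
Variables (R : realType) (V : eqType) (e : rel V) (o : V).

Definition walk_of_length (x y : V) : set nat :=
  [set n | exists p : seq V, [/\ path e x p, last x p = y & size p = n]].

(** Junk value 0 when [x] and [y] lie in different connected components. *)
Definition graph_dist (x y : V) : nat :=
  xget 0%N [set n | walk_of_length x y n /\
                    forall k, walk_of_length x y k -> (n <= k)%N].

Definition gromov_product (x y : V) : R :=
  ((graph_dist o x)%:R + (graph_dist o y)%:R - (graph_dist x y)%:R) / 2.

Definition hyperbolic_with (delta : R) : Prop :=
  forall x y z : V,
    Num.min (gromov_product x z) (gromov_product z y) - delta
      <= gromov_product x y.

Variable a : R.

Definition rho (x y : V) : R :=
  if x == y then 0 else expR (- a * gromov_product x y).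

Definition rho_cauchy (x : nat -> V) : Prop :=
  forall eps : R, 0 < eps -> exists N : nat, forall n k : nat,
    (N <= n)%N -> (N <= k)%N -> rho (x n) (x k) < eps.

Definition cauchy_class (x : nat -> V) : set (nat -> V) :=
  [set y | rho_cauchy y /\ rho (x n) (y n) @[n --> \oo] --> 0].

Definition completion : set (set (nat -> V)) := cauchy_class @` rho_cauchy.

(** [V] sits in its completion through the constant sequences. *)
Definition hyp_boundary : set (set (nat -> V)) :=
  completion `\` range (fun v : V => cauchy_class (fun=> v)).

(** As [rho] is only comparable to a metric, [rho (x n) (y n)] need not
    converge.  The extension is the usual one, [exp (- a * (xi | eta))], where
    [(xi | eta)] is the infimum of [liminf_n (x_n | y_n)] over all sequences
    representing [xi] and [eta]; it is 0 when [xi = eta]. *)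
Definition rho_ext (xi eta : set (nat -> V)) : R :=
  sup [set limn_sup (fun n => rho (x n) (y n)) | x in xi & y in eta].

End Graph.

Definition lipschitz_equivalent (R : realType) (T1 T2 : Type)
    (D1 : set T1) (d1 : T1 -> T1 -> R) (D2 : set T2) (d2 : T2 -> T2 -> R) :=
  exists sigma : T1 -> T2, set_bij D1 D2 sigma /\
  exists C : R, 0 < C /\
    forall x y, D1 x -> D1 y ->
      C^-1 * d1 x y <= d2 (sigma x) (sigma y) <= C * d1 x y.

Definition similitude (R : realType) (d : nat) (r : R) (Q : 'M[R]_d)
  (t x : 'cV[R]_d) : 'cV[R]_d := r *: (Q *m x) + t.

Section AugmentedTree.
Variables (m : nat) (E : Type) (S : 'I_m -> E -> E) (J : set E).

Local Notation word := (seq 'I_m).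

Definition map_of_word (u : word) : E -> E :=
  foldr (fun i f => S i \o f) id u.

Definition cell (u : word) : set E := map_of_word u @` J.

Definition vedge : rel word :=
  [rel u v | [exists i : 'I_m, (v == rcons u i) || (u == rcons v i)]].

Definition hedge : rel word :=
  [rel u v | [&& size u == size v, u != v & `[< cell u `&` cell v !=set0 >]]].

Definition aug_edge : rel word := [rel u v | vedge u v || hedge u v].

Definition level (n : nat) : {pred word} := [pred u | size u == n].

Definition hconnected (T : {fset word}) : Prop :=
  T != fset0 /\
  forall u v, u \in T -> v \in T ->
    exists p : seq word,
      [/\ path hedge u p, {subset p <= T} & last u p = v].

Definition hcomponent_of (W : {pred word}) (T : {fset word}) : Prop :=
  [/\ {subset T <= W}, hconnected T &
      forall T' : {fset word}, {subset T' <= W} -> hconnected T' ->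
        (T `<=` T')%fset -> T' = T].

Definition hcomponent (T : {fset word}) : Prop :=
  exists n : nat, hcomponent_of (level n) T.

Definition offspring (T : {fset word}) : {fset word} :=
  [fset rcons u i | u in T, i in 'I_m]%fset.

Definition comp_equiv (T T' : {fset word}) : Prop :=
  exists g : word -> word,
    set_bij [set` (T `|` offspring T)%fset] [set` (T' `|` offspring T')%fset] g /\
    {in (T `|` offspring T)%fset &, forall u v,
        vedge (g u) (g v) = vedge u v /\ hedge (g u) (g v) = hedge u v}.

Definition connected_class (T : {fset word}) : set {fset word} :=
  [set T' | hcomponent T' /\ comp_equiv T T'].

Definition connected_classes : set (set {fset word}) :=
  connected_class @` hcomponent.

Definition simple_tree : Prop := finite_set connected_classes.

Variables (kappa : nat) (cls : 'I_kappa -> set {fset word}).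

Definition enumerates_classes : Prop := set_bij setT connected_classes cls.

(** The entries must not depend on the component chosen in the class. *)
Definition is_incidence_matrix (A : 'M[nat]_kappa) : Prop :=
  forall (i j : 'I_kappa) (T : {fset word}),
    hcomponent T -> connected_class T = cls i ->
    A i j = #|` [fset Z in fpowerset (offspring T) |
                  `[< hcomponent_of (mem (offspring T)) Z /\
                      connected_class Z = cls j >]]%fset |.

Definition is_size_vector (b : 'cV[nat]_kappa) : Prop :=
  forall (i : 'I_kappa) (T : {fset word}),
    hcomponent T -> connected_class T = cls i -> b i 0 = #|` T|.

End AugmentedTree.

Definition primitive (kappa : nat) (A : 'M[nat]_kappa) : Prop :=
  exists n : nat, (0 < n)%N /\ forall i j, (0 < (A ^+ n) i j)%N.

Definition row_rearrangeable (kappa M : nat) (b : 'cV[nat]_kappa)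
    (v : 'rV[nat]_kappa) : Prop :=
  exists p : nat, (0 < p)%N /\
  exists C : 'M[nat]_(p, kappa), v = const_mx 1%N *m C /\ C *m b = const_mx M.

Definition rearrangeable (kappa M : nat) (b : 'cV[nat]_kappa)
    (A : 'M[nat]_kappa) : Prop :=
  forall i : 'I_kappa, row_rearrangeable M b (row i A).

(* Main.v *)
Require Import Defs.
From HB Require Import structures.
From mathcomp Require Import all_boot all_order all_algebra finmap.
From mathcomp Require Import all_classical all_reals all_analysis.
From mathcomp Require Import zify ring.

(** The horizontal components form a tree, because neighbouring words have equal
    or neighbouring ancestors ([hlinked_take]), and by simplicity they have bounded
    size.  Collapsing them changes graph distances by at most a constant, so the
    boundary of the augmented tree is the boundary of the tree of components.  It
    has to be compared with the boundary of the tree of words.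

    Rearrangeability.  The entry [A ^ k i j] counts the components of class [j]
    in the [k]-th generation below a component [T] of class [i]
    ([count_descendants]); their sizes add up to [m ^ k] times the cardinal of [T].
    They have to be split into as many groups as [T] has elements, each group of
    total size [m ^ k].  This is a bin packing problem with items of bounded size,
    and the greedy method solves it once there are enough items of size one to fill
    the gaps ([pack_bins]).  The root is a component of size one, so primitivity
    supplies as many such items as needed when [k] is large
    ([abundant_singletons]).

    Lipschitz equivalence.  Attach every group to one element of [T], as its new
    offspring.  This rewires the levels that are multiples of [k] into a tree in
    which each word has [m ^ k] successors, like the tree of words, and in which a
    component has a single parent ([rewiring_of_fair_share]).  Hence the infinite
    sequences of blocks of length [k] code the branches of the rewired tree, and
    these code the boundary: each chain of nested components is followed by exactly
    one branch ([end_of_surj], [end_of_neq]).  When two codes differ first at the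
    block [N], their branches lie in the same component at the level [N * k], and
    in different ones at the level [(N + 2) * k], where even the parents differ.
    As the Gromov product is the level of separation up to a constant
    ([gromov_product_ge], [agree_of_gromov_product]), the distance of the two ends
    is comparable with [exp (- a * N * k)] ([rho_ext_between]).  The tree of words
    is covered by the same statements, with trivial components and concatenation as
    the rewiring; so the two boundaries, coded by the same sequences, are Lipschitz
    equivalent ([lipschitz_of_rewirings]). *)

Set Implicit Arguments.
Unset Strict Implicit.
Unset Printing Implicit Defensive.

Import Order.TTheory GRing.Theory Num.Theory.
Import numFieldNormedType.Exports.

(** * Packing weighted items into bins *)

(** Greedy packing: the heavy items go in first, into any bin that still has
    room; the unit items held back guarantee that such a bin exists, and in the
    end they fill every gap exactly. *)
Lemma pack_bins (I : eqType) (G : finType) (w : I -> nat) (B : nat)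
    (s : seq I) (c : G -> nat) :
  uniq s -> {in s, forall z, 0 < w z <= B} ->
  \sum_(g : G) c g = \sum_(z <- s) w z ->
  {in s, forall z, w z = 1} \/ #|G| * B <= count (fun z => w z == 1) s ->
  exists f : I -> option G,
    {in s, forall z, f z} /\
    forall g, \sum_(z <- s | f z == Some g) w z = c g.
Proof.
have [n] := ubnP (size s); elim: n => // n IHn in s c *.
rewrite ltnS => szs us ws cs ones.
case: (posnP (size s)) => [/size0nil s0|s_gt0].
  move: cs; rewrite s0 big_nil => /eqP; rewrite sum_nat_eq0 => /forallP c0.
  exists (fun=> None); split=> [z|g]; first by rewrite in_nil => /negPn.
  by rewrite big_nil; apply/esym/eqP/c0.
(* The next item: a heavy one as long as there is one. *)
have [z [zs zw]] : exists z, z \in s /\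
    (w z != 1 \/ {in s, forall z, w z = 1}).
  case: (altP (@allP _ (fun z => w z == 1) s)) => [ones1|/allPn[z zs zw]].
    case: s s_gt0 {IHn szs us ws cs ones} ones1 => // z s _ ones1.
    exists z; split; first exact: mem_head.
    by right=> x /ones1/eqP.
  by exists z; split=> //; left.
have /andP[wz_gt0 wzB] := ws _ zs.
have szE : \sum_(x <- s) w x = w z + \sum_(x <- rem z s) w x.
  by rewrite (big_rem z).
have cnt : count (fun x => w x == 1) s =
    (w z == 1) + count (fun x => w x == 1) (rem z s).
  by rewrite (permP (perm_to_rem zs)).
(* For a heavy [z]: if no bin had room for it, the total room would be less than
   [#|G| * B], whereas the unit items alone weigh that much.  For a unit item, any
   bin that is not full will do. *)
have [g0 wg0] : exists g, w z <= c g.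
  apply/existsP; apply: contraT; rewrite negb_exists => /forallP small.
  have {small} lt_c g : (c g).+1 <= w z by rewrite ltnNge; exact: small.
  have: \sum_(g : G) (c g).+1 <= #|G| * w z.
    by rewrite -sum_nat_const; exact: leq_sum.
  rewrite (eq_bigr (fun g => c g + 1)) => [|g _]; last by rewrite addn1.
  rewrite big_split /= sum1_card cs szE.
  case: zw => [zw1|ones1].
    case: ones => [/(_ _ zs) zw|]; first by rewrite zw in zw1.
    rewrite cnt (negPf zw1) add0n => GB.
    have: count (fun x => w x == 1) (rem z s) <= \sum_(x <- rem z s) w x.
      rewrite -sum1_count big_mkcond /=; apply: leq_sum => x _.
      by case: eqP => // ->.
    have: #|G| * w z <= #|G| * B by rewrite leq_mul2l wzB orbT.
    move=> h1 h2 h3; move: wz_gt0.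
    have := leq_trans h3 (leq_trans h1 (leq_trans GB h2)).
    rewrite addnAC addnC -[X in _ <= X]addn0 leq_add2l leqn0 addn_eq0.
    by case/andP=> /eqP ->.
  by rewrite (ones1 _ zs) muln1 add1n addSn ltnNge leq_addl.
pose c' g := if g == g0 then c g - w z else c g.
have cE g : c g = c' g + (if g == g0 then w z else 0).
  by rewrite /c'; case: eqP => [->|_]; rewrite ?subnK ?addn0.
have [|||||f [fs fc]] := IHn (rem z s) c'.
- by rewrite size_rem // prednK.
- exact: rem_uniq.
- by move=> x /mem_rem; exact: ws.
- apply/eqP; rewrite -(eqn_add2l (w z)) -szE -cs.
  under [X in _ == X]eq_bigr do rewrite cE.
  by rewrite big_split /= -big_mkcond big_pred1_eq addnC.
- case: zw => [zw1|ones1]; last by left=> x /mem_rem; exact: ones1.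
  case: ones => [ones1|GB]; first by left=> x /mem_rem; exact: ones1.
  by right; move: GB; rewrite cnt (negPf zw1).
exists (fun x => if x == z then Some g0 else f x); split=> [x xs|g].
  case: eqP => // /eqP xz; apply: fs.
  by rewrite (rem_filter _ us) mem_filter /= xz.
rewrite (perm_big _ (perm_to_rem zs)) /= big_cons eqxx cE -fc.
have -> : \sum_(x <- rem z s | (if x == z then Some g0 else f x) == Some g) w x =
    \sum_(x <- rem z s | f x == Some g) w x.
  rewrite big_seq_cond [RHS]big_seq_cond; apply: eq_bigl => x.
  by rewrite (rem_filter _ us) mem_filter /=; case: eqP.
rewrite (inj_eq Some_inj) [g == g0]eq_sym; case: eqP => _.
  by rewrite addnC.
by rewrite addn0.
Qed.

(** * Horizontal components *)

Local Open Scope classical_set_scope.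

Section Components.
Variables (m : nat) (E : Type) (S : 'I_m -> E -> E) (J : set E).
Local Notation word := (seq 'I_m).
Local Notation hedge := (hedge S J).

(** Horizontal components are handled through this equivalence relation, whose
    classes they are. *)
Definition hlinked (u v : word) : Prop :=
  exists p, path hedge u p /\ last u p = v.

Lemma hedge_sym u v : hedge u v = hedge v u.
Proof. by rewrite /Defs.hedge /= eq_sym (eq_sym u) setIC. Qed.

Lemma hlinked_refl u : hlinked u u.
Proof. by exists [::]. Qed.

Lemma hlinked_trans v u w : hlinked u v -> hlinked v w -> hlinked u w.
Proof.
move=> [p [up <-]] [q [vq <-]]; exists (p ++ q).
by rewrite cat_path up last_cat.
Qed.

Lemma hlinked_hedge u v : hedge u v -> hlinked u v.
Proof. by move=> uv; exists [:: v]; rewrite /= uv. Qed.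

Lemma hlinked_sym u v : hlinked u v -> hlinked v u.
Proof.
move=> [p]; elim: p u => [|w p IHp] u /= []; first by move=> _ ->; exact: hlinked_refl.
case/andP=> uw wp pv; apply: (hlinked_trans (v := w)); first exact: IHp.
by apply: hlinked_hedge; rewrite hedge_sym.
Qed.

Lemma hlinked_size u v : hlinked u v -> size u = size v.
Proof.
move=> [p]; elim: p u => [|w p IHp] u /= [] => [_ -> //|].
by case/andP=> /and3P[/eqP-> _ _] wp pv; exact: IHp.
Qed.

Definition words (n : nat) : {fset word} :=
  [fset tval t | t : n.-tuple 'I_m]%fset.

Lemma mem_words n u : (u \in words n) = (size u == n).
Proof.
apply/imfsetP/idP => [[t _ ->]|un]; first by rewrite size_tuple.
by exists (Tuple un).
Qed.

Definition hcomp (u : word) : {fset word} :=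
  [fset v in words (size u) | `[< hlinked u v >]]%fset.

Lemma mem_comp u v : (v \in hcomp u) = `[< hlinked u v >].
Proof.
rewrite !inE mem_words /=; case: asboolP => uv; rewrite ?andbF //.
by rewrite (hlinked_size uv) eqxx.
Qed.

Lemma hcompP u v : reflect (hlinked u v) (v \in hcomp u).
Proof. by rewrite mem_comp; exact: asboolP. Qed.

Lemma hcomp_eq u v : hcomp u = hcomp v <-> hlinked u v.
Proof.
split=> [uv|uv]; first by apply/hcompP; rewrite uv; apply/hcompP/hlinked_refl.
apply/fsetP => w; apply/hcompP/hcompP; apply: hlinked_trans => //.
exact: hlinked_sym.
Qed.

Definition hcomps (W : {fset word}) : {fset {fset word}} :=
  [fset hcomp u | u in W]%fset.

Lemma hcompsP W Z : reflect (exists2 u, u \in W & Z = hcomp u) (Z \in hcomps W).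
Proof. exact: imfsetP. Qed.

Definition saturated (W : {pred word}) : Prop :=
  forall u v, hlinked u v -> u \in W -> v \in W.

Lemma saturated_hcomp u : saturated (mem (hcomp u)).
Proof. by move=> v w vw /hcompP uv; apply/hcompP/(hlinked_trans uv). Qed.

Lemma saturated_level n : saturated (@level m n).
Proof. by move=> u v /hlinked_size uv; rewrite !inE uv. Qed.

Lemma hconnected_hcomp u : hconnected S J (hcomp u).
Proof.
split; first by apply/fset0Pn; exists u; apply/hcompP/hlinked_refl.
move=> v w /hcompP uv /hcompP uw.
have [p [vp pw]] := hlinked_trans (hlinked_sym uv) uw.
exists p; split=> // x xp; apply/hcompP/(hlinked_trans uv).
by case/splitPr: xp vp pw => p1 p2; rewrite cat_path /= => /and3P[h1 h2 _] _;
  exists (rcons p1 x); rewrite rcons_path h1 h2 last_rcons.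
Qed.

(** A saturated set is a union of full components, so maximality inside it is
    the same as maximality in the whole level. *)
Lemma hcomponent_ofP (W : {pred word}) Z : saturated W ->
  hcomponent_of S J W Z <-> exists2 u, u \in W & Z = hcomp u.
Proof.
move=> satW; split=> [[ZW Zc Zmax]|[u uW ->{Z}]].
  have [/fset0Pn[u uZ] Zp] := Zc; exists u; first exact: ZW.
  apply/esym/Zmax; first by move=> v /hcompP uv; exact: satW uv (ZW _ uZ).
    exact: hconnected_hcomp.
  apply/fsubsetP => v vZ; apply/hcompP.
  by have [p [up _ pv]] := Zp _ _ uZ vZ; exists p.
split; [|exact: hconnected_hcomp|].
  by move=> v /hcompP uv; exact: satW uv uW.
move=> T _ [_ Tp] /fsubsetP uT; apply/eqP; rewrite eqEfsubset.
apply/andP; split; apply/fsubsetP => // v vT; apply/hcompP.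
have uTT : u \in T by apply/uT/hcompP/hlinked_refl.
by have [p [up _ pv]] := Tp _ _ uTT vT; exists p.
Qed.

Lemma hcomponentP Z : hcomponent S J Z <-> exists u, Z = hcomp u.
Proof.
split=> [[n]|[u ->]].
  by case/(hcomponent_ofP _ (@saturated_level n)) => u _ ->; exists u.
exists (size u); apply/(hcomponent_ofP _ (@saturated_level _)).
by exists u => //; rewrite inE.
Qed.

Lemma card_hcomps_sum (W : {fset word}) : saturated (mem W) ->
  \sum_(Z <- hcomps W) #|` Z| = #|` W|.
Proof.
move=> satW; rewrite card_fset_sum1 (partition_big_imfset _ hcomp) /=.
rewrite big_seq [RHS]big_seq; apply: eq_bigr => _ /hcompsP[u uW ->].
rewrite card_fset_sum1 [RHS]big_fset_condE; apply: eq_fbigl => v.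
rewrite !inE /= mem_words; apply/andP/andP => [[_ /asboolP uv]|[vW /eqP/hcomp_eq vu]].
  by split; [exact: satW uv uW|apply/eqP/hcomp_eq/hlinked_sym].
by split; [rewrite (hlinked_size vu)|apply/asboolP/hlinked_sym].
Qed.

Lemma offspringP (W : {fset word}) x :
  reflect (exists2 u, u \in W & exists i, x = rcons u i) (x \in offspring W).
Proof.
apply: (iffP (imfset2P _ _ _ _ _)) => [[u uW [i _ ->]]|[u uW [i ->]]].
  by exists u => //; exists i.
by exists u => //; exists i.
Qed.

Lemma card_offspring (W : {fset word}) : #|` offspring W| = (#|` W| * m)%N.
Proof.
rewrite card_fset_sum1 big_imfset2 /=; last first.
  move=> [u i] [v j] _ _ /= uv; move: (rcons_inj uv) => [-> ->] //.
rewrite [in RHS]card_fset_sum1 big_distrl /=; apply: eq_bigr => u _.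
by rewrite mul1n big_enum sum1_card card_ord.
Qed.

Hypothesis SJ : forall i, S i @` J `<=` J.

Lemma cell_take l u : cell S J u `<=` cell S J (take l u).
Proof.
have mapJ w x : J x -> J (map_of_word S w x).
  by elim: w => //= i w IHw Jx; apply: (SJ (i := i)); exists (map_of_word S w x);
    [exact: IHw|].
have mapcat w1 w2 x :
    map_of_word S (w1 ++ w2) x = map_of_word S w1 (map_of_word S w2 x).
  by elim: w1 => //= i w IHw; rewrite IHw.
move=> _ [x Jx <-]; exists (map_of_word S (drop l u) x); first exact: mapJ.
by rewrite -mapcat cat_take_drop.
Qed.

(** Cells decrease along the tree, so horizontal neighbours have equal or
    neighbouring ancestors: the components form a tree of their own. *)
Lemma hlinked_take l u v : hlinked u v -> hlinked (take l u) (take l v).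
Proof.
move=> [p]; elim: p u => [|w p IHp] u /= []; first by move=> _ ->; exact: hlinked_refl.
case/andP=> /and3P[/eqP suw _ /asboolP[x [xu xw]]] wp pv.
apply: (hlinked_trans (v := take l w)); last exact: IHp.
have [->|neq] := eqVneq (take l u) (take l w); first exact: hlinked_refl.
apply: hlinked_hedge; rewrite /Defs.hedge /= neq !size_take suw eqxx /=.
by apply/asboolP; exists x; split; apply: cell_take.
Qed.

Lemma saturated_offspring (W : {fset word}) :
  saturated (mem W) -> saturated (mem (offspring W)).
Proof.
move=> satW x y xy /offspringP[u uW [i xE]]; apply/offspringP.
case/lastP: y xy => [|v j] xy.
  by have := hlinked_size xy; rewrite xE size_rcons.
exists v; last by exists j.
apply: satW uW; have := hlinked_take (size u) xy; rewrite xE.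
have := hlinked_size xy; rewrite xE !size_rcons => -[uv].
by rewrite -!cats1 take_size_cat // uv take_size_cat.
Qed.

Lemma hcomps_offspring (W : {fset word}) : saturated (mem W) ->
  hcomps (offspring W) = (\bigcup_(Z <- hcomps W) hcomps (offspring Z))%fset.
Proof.
move=> satW; apply/fsetP => Z; apply/hcompsP/bigfcupP.
  move=> [x /offspringP[u uW [i xE]] ->]; exists (hcomp u).
    by rewrite andbT; apply/hcompsP; exists u.
  apply/hcompsP; exists x => //; apply/offspringP; exists u; last by exists i.
  exact/hcompP/hlinked_refl.
move=> [_ /andP[/hcompsP[u uW ->] _] /hcompsP[x /offspringP[v /hcompP uv [i xE]] ->]].
exists x => //; apply/offspringP; exists v; last by exists i.
exact: satW uv uW.
Qed.

Lemma disjoint_hcomps_offspring Z1 Z2 :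
  hcomponent S J Z1 -> hcomponent S J Z2 -> Z1 != Z2 ->
  [disjoint hcomps (offspring Z1) & hcomps (offspring Z2)]%fset.
Proof.
move=> /hcomponentP[u1 ->] /hcomponentP[u2 ->]; apply: contraNT.
rewrite -fsetI_eq0 => /fset0Pn[Z]; rewrite inE.
case/andP=> /hcompsP[_ /offspringP[v1 /hcompP uv1 [i1 ->]] ->].
case/hcompsP=> [_ /offspringP[v2 /hcompP uv2 [i2 ->]] /hcomp_eq v12].
apply/eqP/hcomp_eq/(hlinked_trans uv1)/hlinked_sym/(hlinked_trans uv2)/hlinked_sym.
have := hlinked_take (size v1) v12.
have := hlinked_size v12; rewrite !size_rcons => -[s12].
by rewrite -!cats1 take_size_cat // s12 take_size_cat.
Qed.

Definition descendants (k : nat) (W : {fset word}) := iter k (@offspring m) W.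

Lemma saturated_descendants k (W : {fset word}) :
  saturated (mem W) -> saturated (mem (descendants k W)).
Proof. by move=> satW; elim: k => //= k; exact: saturated_offspring. Qed.

Lemma card_descendants k (W : {fset word}) :
  #|` descendants k W| = (#|` W| * m ^ k)%N.
Proof. by elim: k => [|k IHk]; rewrite ?muln1 //= card_offspring IHk expnSr mulnA. Qed.

Lemma descendantsP k (W : {fset word}) x :
  reflect (k <= size x /\ take (size x - k) x \in W) (x \in descendants k W).
Proof.
elim: k x => [|k IHk] x /=.
  by apply: (iffP idP); rewrite subn0 take_size; [|case].
apply: (iffP (offspringP _ _)) => [[u /IHk[ku uW] [i ->]]|[]].
  by rewrite size_rcons subSS -cats1 takel_cat ?leq_subr.
case/lastP: x => // u i; rewrite size_rcons subSS -cats1 takel_cat ?leq_subr //.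
by move=> ku uW; exists u; [apply/IHk|exists i; rewrite cats1].
Qed.

End Components.

(** * Counting descendants by connected class *)

Section Classes.
Variables (m : nat) (E : Type) (S : 'I_m -> E -> E) (J : set E).
Local Notation word := (seq 'I_m).
Local Notation hcomp := (hcomp S J).
Local Notation hcomps := (hcomps S J).
Local Notation hcomponent := (hcomponent S J).
Local Notation connected_class := (connected_class S J).

Variables (kappa : nat) (cls : 'I_kappa -> set {fset word}).
Variables (A : 'M[nat]_kappa) (b : 'cV[nat]_kappa).
Hypothesis SJ : forall i, S i @` J `<=` J.
Hypothesis clsE : enumerates_classes S J cls.
Hypothesis AE : is_incidence_matrix S J cls A.
Hypothesis bE : is_size_vector S J cls b.

Definition in_class (j : 'I_kappa) (Z : {fset word}) : bool :=
  `[< connected_class Z = cls j >].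

Lemma class_index Z : hcomponent Z -> exists i, connected_class Z = cls i.
Proof.
move=> Zc; have [_ _ surj] := clsE.
have [|i _ iZ] := surj (connected_class Z); first by exists Z.
by exists i.
Qed.

Lemma class_witness i : exists2 T, hcomponent T & connected_class T = cls i.
Proof. by have [/(_ i I)[T Tc TE] _ _] := clsE; exists T. Qed.

Lemma sum_in_class i Z (F : 'I_kappa -> nat) : connected_class Z = cls i ->
  \sum_j in_class j Z * F j = F i.
Proof.
move=> Zi; rewrite (bigD1 i) //= big1 ?addn0 => [|j ji].
  by rewrite /in_class Zi asboolT // mul1n.
rewrite /in_class Zi asboolF ?mul0n // => ij; case/eqP: ji.
by have [_ inj _] := clsE; apply: inj; rewrite ?inE.
Qed.

Lemma hcomps_hcomponent (W : {fset word}) Z : Z \in hcomps W -> hcomponent Z.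
Proof. by case/hcompsP=> u _ ->; apply/hcomponentP; exists u. Qed.

Lemma count_offspring i j T : hcomponent T -> connected_class T = cls i ->
  \sum_(Z <- hcomps (offspring T)) in_class j Z = A i j.
Proof.
move=> Tc Ti; rewrite (AE j Tc Ti).
have /hcomponentP[u TE] := Tc.
have satT : saturated S J (mem (offspring T)).
  by apply: saturated_offspring => //; rewrite TE; exact: saturated_hcomp.
transitivity (\sum_(Z <- hcomps (offspring T) | in_class j Z) 1).
  by rewrite [RHS]big_mkcond; apply: eq_bigr => Z _; case: in_class.
rewrite card_fset_sum1 big_fset_condE; apply: eq_fbigl => Z.
rewrite !inE; apply/andP/andP => /= [[/hcompsP[x xT ZE] Zj]|[_ /asboolP[Zc Zj]]].
  have Zc : hcomponent_of S J (mem (offspring T)) Z.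
    by apply/hcomponent_ofP => //; exists x.
  split; last by apply/asboolP; split=> //; apply/asboolP.
  by rewrite fpowersetE; apply/fsubsetP; case: Zc.
split; last exact/asboolP.
by apply/hcompsP; move/(hcomponent_ofP _ satT): Zc.
Qed.

(** A component of generation [k + 1] has exactly one parent component of
    generation [k], so the counts multiply like the matrix. *)
Lemma count_descendants k i j T : hcomponent T -> connected_class T = cls i ->
  \sum_(Z <- hcomps (descendants k T)) in_class j Z = (A ^+ k)%R i j.
Proof.
move=> Tc Ti; have /hcomponentP[u TE] := Tc.
have satD l : saturated S J (mem (descendants l T)).
  by apply: saturated_descendants => //; rewrite TE; exact: saturated_hcomp.
elim: k j => [|k IHk] j /=.
  have -> : hcomps T = [fset T]%fset.
    apply/fsetP => Z; rewrite inE; apply/hcompsP/eqP => [[v vT ->]|->].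
      by rewrite TE; apply/hcomp_eq/hlinked_sym/hcompP; rewrite -TE.
    by exists u => //; rewrite TE; apply/hcompP/hlinked_refl.
  rewrite big_seq_fset1 mxE /in_class Ti; case: eqP => [->|ij].
    by rewrite asboolT.
  rewrite asboolF // => eij; apply: ij.
  by have [_ inj _] := clsE; apply: inj; rewrite ?inE.
rewrite exprSr mxE hcomps_offspring // partition_disjoint_bigfcup; last first.
  by move=> Z1 Z2 /hcomps_hcomponent Z1c /hcomps_hcomponent Z2c;
    exact: disjoint_hcomps_offspring.
transitivity (\sum_(Z <- hcomps (descendants k T)) \sum_l in_class l Z * A l j).
  rewrite big_seq [RHS]big_seq; apply: eq_bigr => Z /hcomps_hcomponent Zc.
  have [l Zl] := class_index Zc.
  by rewrite (count_offspring j Zc Zl) (sum_in_class _ Zl).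
rewrite exchange_big /=; apply: eq_bigr => l _.
by rewrite -big_distrl /= IHk.
Qed.

Lemma incidence_pow_size k i :
  \sum_j (A ^+ k)%R i j * b j 0%R = b i 0%R * m ^ k.
Proof.
have [T Tc Ti] := class_witness i.
have /hcomponentP[u TE] := Tc.
rewrite (bE Tc Ti) -card_descendants -(@card_hcomps_sum _ _ S J); last first.
  by apply: saturated_descendants => //; rewrite TE; exact: saturated_hcomp.
under eq_bigr do rewrite -(count_descendants _ _ Tc Ti) big_distrl /=.
rewrite exchange_big /= big_seq [RHS]big_seq.
apply: eq_bigr => Z /hcomps_hcomponent Zc.
have [l Zl] := class_index Zc.
by rewrite (sum_in_class (fun j => b j 0%R) Zl) (bE Zc Zl).
Qed.

Lemma card_hcomponent_gt0 Z : hcomponent Z -> 0 < #|` Z|.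
Proof.
case/hcomponentP=> u ->; rewrite cardfs_gt0; apply/fset0Pn; exists u.
exact/hcompP/hlinked_refl.
Qed.

Lemma size_vector_gt0 i : 0 < b i 0%R.
Proof.
by have [T Tc Ti] := class_witness i; rewrite (bE Tc Ti) card_hcomponent_gt0.
Qed.

Definition max_size : nat := \max_i b i 0%R.

Lemma card_hcomponent_le_max Z : hcomponent Z -> #|` Z| <= max_size.
Proof.
move=> Zc; have [i Zi] := class_index Zc.
by rewrite -(bE Zc Zi) /max_size (leq_bigmax i).
Qed.

Lemma max_size1 : m = 1 -> max_size <= 1.
Proof.
move=> m1; apply/bigmax_leqP => i _; have [T Tc Ti] := class_witness i.
rewrite (bE Tc Ti); have /hcomponentP[u ->] := Tc.
have: (hcomp u `<=` words m (size u))%fset.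
  by apply/fsubsetP => v /hcompP/hlinked_size uv; rewrite mem_words uv.
move/fsubset_leq_card/leq_trans; apply; apply: leq_trans (leq_imfset_card _ _ _) _.
by rewrite size_tuple card_tuple card_ord; move: (size u) => n; rewrite m1 exp1n.
Qed.

(** The class [j0] of the root consists of singletons.  Since [A ^ q * b] is
    [m ^ q] times [b], the rows of [A ^ q] carry a weight that grows with [q]; one
    further positive power spreads it over all columns, in particular over the
    column [j0].  If [m] is 1 the weight does not grow, but then every component
    is a singleton and the bound reads 1 <= 1. *)
Lemma abundant_singletons : primitive A ->
  exists j0, b j0 0%R = 1 /\
  exists k, 0 < k /\ forall i, b i 0%R * max_size <= (A ^+ k)%R i j0.
Proof.
move=> [n [n_gt0 An]].
have rootc : hcomponent (hcomp [::]) by apply/hcomponentP; exists [::].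
have [j0 j0E] := class_index rootc; exists j0; split.
  rewrite (bE rootc j0E); apply/eqP; rewrite eqn_leq card_hcomponent_gt0 // andbT.
  have -> : hcomp [::] = [fset [::]]%fset; last by rewrite cardfs1.
  apply/fsetP => v; rewrite inE; apply/hcompP/eqP => [/hlinked_size/esym/size0nil //|->].
  exact: hlinked_refl.
have m_gt0 : 0 < m.
  have: 0 < b j0 0%R * m ^ n.
    rewrite -incidence_pow_size (bigD1 j0) //=.
    by rewrite addn_gt0 muln_gt0 An size_vector_gt0.
  by rewrite muln_gt0 expn_gt0 size_vector_gt0 eqn0Ngt n_gt0 orbF.
have [q mq] : exists q, max_size * max_size <= m ^ q.
  case: (ltngtP m 1) m_gt0 => // [m_gt1|m1] _.
    by exists (max_size * max_size); exact/ltnW/ltn_expl.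
  by exists 0; rewrite expn0 (leq_mul (max_size1 m1) (max_size1 m1)).
exists (q + n)%N; split=> [|i]; first by rewrite addn_gt0 n_gt0 orbT.
have max_gt0 : 0 < max_size.
  exact: leq_trans (size_vector_gt0 j0) (leq_bigmax j0).
(* Bound [A ^ n] below by 1, and each entry of [b] above by [max_size]; the
   second estimate is why the square of [max_size] was asked for. *)
rewrite exprD mxE -(leq_pmul2r max_gt0).
apply: (@leq_trans (b i 0%R * m ^ q)); first by rewrite -mulnA leq_mul2l mq orbT.
rewrite -incidence_pow_size big_distrl /=; apply: leq_sum => l _.
rewrite -[leqRHS]mulnA leq_mul2l; apply/orP; right.
apply: leq_trans (leq_bigmax (F := fun i => b i 0%R) l) _.
by rewrite leq_pmull.
Qed.

(** Rearrangeability realized on the components themselves: [f] deals the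
    components of the [k]-th generation below [T] out to the elements of [T].  The
    shares then have to be [m ^ k], since [k] generations multiply cardinals by
    that number. *)
Definition fair_share (k : nat) : Prop :=
  forall T, hcomponent T -> exists f : {fset word} -> word,
    {in hcomps (descendants k T), forall Z, f Z \in T} /\
    {in T, forall v,
      \sum_(Z <- hcomps (descendants k T) | f Z == v) #|` Z| = m ^ k}.

Lemma fair_share_of_singletons k j0 : b j0 0%R = 1 ->
  (forall i, b i 0%R * max_size <= (A ^+ k)%R i j0) -> fair_share k.
Proof.
move=> bj0 Ak T Tc; have [i Ti] := class_index Tc.
have /hcomponentP[u TE] := Tc.
have satD : saturated S J (mem (descendants k T)).
  by apply: saturated_descendants => //; rewrite TE; exact: saturated_hcomp.
have [||||f [fs fc]] := @pack_bins _ T (fun Z : {fset word} => #|` Z|) max_size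
  (hcomps (descendants k T)) (fun=> m ^ k).
- exact: fset_uniq.
- by move=> Z /hcomps_hcomponent Zc; rewrite card_hcomponent_gt0 // card_hcomponent_le_max.
- by rewrite card_hcomps_sum // card_descendants sum_nat_const cardfE.
- right; rewrite -cardfE -(bE Tc Ti); apply: leq_trans (Ak i) _.
  rewrite -(count_descendants _ _ Tc Ti) -sum1_count [leqRHS]big_mkcond /=.
  rewrite big_seq [leqRHS]big_seq; apply: leq_sum => Z /hcomps_hcomponent Zc.
  by rewrite /in_class; case: asboolP => // Zj; rewrite -(bE Zc Zj) bj0 eqxx.
exists (fun Z => if f Z is Some v then val v else [::]); split.
  by move=> Z /fs; case: (f Z) => // v _; exact: valP.
move=> v vT; rewrite -(fc [` vT]%fset) [LHS]big_seq_cond [RHS]big_seq_cond.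
apply: eq_bigl => Z; apply: andb_id2l => ZD; have := fs Z ZD.
by case: (f Z) => // w _; rewrite (inj_eq Some_inj) -val_eqE.
Qed.

(** The row of the rearranging matrix that belongs to an element of [T] counts, by
    class, the components dealt to this element. *)
Lemma rearrangeable_of_fair_share k :
  fair_share k -> rearrangeable (m ^ k) b (A ^+ k)%R.
Proof.
move=> fair i; have [T Tc Ti] := class_witness i.
have [f [fT fsum]] := fair T Tc.
exists #|` T|; split; first exact: card_hcomponent_gt0.
pose v (g : 'I_#|` T|) : word := nth [::] T g.
have vT g : v g \in T by rewrite mem_nth.
pose n (x : word) j := \sum_(Z <- hcomps (descendants k T) | f Z == x) in_class j Z.
exists (\matrix_(g, j) n (v g) j)%R; split.
  apply/rowP => j; rewrite !mxE.
  transitivity (\sum_(g < #|` T|) n (v g) j); last first.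
    by apply: eq_bigr => g _; rewrite !mxE mul1r.
  rewrite -(count_descendants _ _ Tc Ti).
  transitivity (\sum_(x <- T) n x j); last by rewrite (big_nth [::]) big_mkord.
  rewrite /n; under [RHS]eq_bigr do rewrite big_mkcond.
  rewrite exchange_big /= big_seq [RHS]big_seq.
  apply: eq_bigr => Z /fT fZ.
  rewrite (bigD1_seq (f Z)) ?fset_uniq //= eqxx big1 ?addn0 // => x xZ.
  by rewrite eq_sym (negPf xZ).
apply/colP => g; rewrite !mxE -(fsum _ (vT g)).
transitivity (\sum_j n (v g) j * b j 0%R).
  by apply: eq_bigr => j _; rewrite mxE.
under eq_bigr do rewrite /n big_distrl /=.
rewrite exchange_big /= big_seq_cond [RHS]big_seq_cond.
apply: eq_bigr => Z /andP[/hcomps_hcomponent Zc _].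
have [l Zl] := class_index Zc.
by rewrite (sum_in_class (fun j => b j 0%R) Zl) (bE Zc Zl).
Qed.

End Classes.

(** * Rewiring the tree along the horizontal components *)

(** [phi v] numbers the new offspring, [k] levels further down, of the word [v]
    by the words of length [k], so that the rewired tree is a copy of the tree of
    all words with steps of length [k].  The second condition keeps new parents in
    the class of the true ancestors; the third, which has force only for classes
    with several elements, makes a whole class have the same new parent. *)
Definition rewiring (m k : nat) (sim : seq 'I_m -> seq 'I_m -> Prop)
    (phi : seq 'I_m -> k.-tuple 'I_m -> seq 'I_m) : Prop :=
  [/\ forall v w, size (phi v w) = size v + k,
      forall v w, sim (take (size v) (phi v w)) v,
      forall v v' w w', sim (phi v w) (phi v' w') -> v = v',
      forall l x, size x = l + k -> exists v w, size v = l /\ x = phi v w &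
      forall v, injective (phi v)].

Lemma rewiring_cat (m k : nat) :
  rewiring eq (fun (v : seq 'I_m) (w : k.-tuple 'I_m) => v ++ w).
Proof.
split=> [v w|v w|v v' w w' vw|l x xl|v w w' /eqP].
- by rewrite size_cat size_tuple.
- by rewrite take_size_cat.
- have sv : size v = size v'.
    have := congr1 size vw; rewrite !size_cat !size_tuple.
    by move/eqP; rewrite eqn_add2r => /eqP.
  by move/eqP: vw; rewrite eqseq_cat // => /andP[/eqP].
- have dk : size (drop l x) == k by rewrite size_drop xl addKn.
  exists (take l x), (Tuple dk); rewrite /= cat_take_drop size_takel //.
  by rewrite xl leq_addr.
- by rewrite eqseq_cat // eqxx => /eqP/val_inj.
Qed.

Section Rewiring.
Variables (m : nat) (E : Type) (S : 'I_m -> E -> E) (J : set E).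
Local Notation word := (seq 'I_m).
Local Notation hcomp := (hcomp S J).
Local Notation hcomps := (hcomps S J).
Hypothesis SJ : forall i, S i @` J `<=` J.

Lemma card_hcomps_sum_cond (W : {fset word}) (P : pred {fset word}) :
  saturated S J (mem W) ->
  \sum_(Z <- hcomps W | P Z) #|` Z| = #|` [fset x in W | P (hcomp x)]%fset|.
Proof.
move=> satW; rewrite -(@card_hcomps_sum _ _ S J) => [|x y xy]; last first.
  rewrite !inE /= => /andP[xW Px]; rewrite (satW _ _ xy) //=.
  by rewrite (_ : hcomp y = hcomp x) //; apply/hcomp_eq/hlinked_sym.
rewrite big_fset_condE; apply: eq_fbigl => Z; rewrite !inE /=.
apply/andP/hcompsP => [[/hcompsP[x xW ->] Px]|[x]].
  by exists x => //; rewrite !inE xW.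
by rewrite !inE => /andP[xW Px] ->; split=> //; apply/hcompsP; exists x.
Qed.

(** The components dealt to [v] become its new offspring: there are as many
    words in them as there are words of length [k], and their true ancestors lie
    in the component of [v]. *)
Lemma rewiring_of_fair_share k :
  fair_share S J k -> exists phi, rewiring (k := k) (hlinked S J) phi.
Proof.
move=> fair.
have [f fP] : {f : {fset word} -> {fset word} -> word | forall T,
    hcomponent S J T -> {in hcomps (descendants k T), forall Z, f T Z \in T} /\
    {in T, forall v,
      \sum_(Z <- hcomps (descendants k T) | f T Z == v) #|` Z| = m ^ k}}.
  have [T|f fP] := @choice _ _ (fun T g => hcomponent S J T ->
    {in hcomps (descendants k T), forall Z, g Z \in T} /\
    {in T, forall v,
      \sum_(Z <- hcomps (descendants k T) | g Z == v) #|` Z| = m ^ k}).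
    have [/fair[g gP]|nT] := pselect (hcomponent S J T); first by exists g.
    by exists (fun=> [::]).
  by exists f.
have hcompc v : hcomponent S J (hcomp v) by apply/hcomponentP; exists v.
(* The new offspring of [v]. *)
pose fib v := [fset x in descendants k (hcomp v) | f (hcomp v) (hcomp x) == v]%fset.
have fibP v x : reflect
    [/\ size x = size v + k, hlinked S J (take (size v) x) v &
        f (hcomp v) (hcomp x) = v] (x \in fib v).
  rewrite !inE /=; apply: (iffP andP) => [[/descendantsP[kx xv] /eqP fv]|[sx xv fv]].
    have sx : size x - k = size v.
      by move/hcompP/hlinked_size: xv; rewrite size_takel // leq_subr.
    by move/hcompP/hlinked_sym: xv; rewrite sx; split=> //; rewrite -sx subnK.
  split; last exact/eqP; apply/descendantsP; rewrite sx leq_addl addnK; split=> //.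
  exact/hcompP/hlinked_sym.
have card_fib v : #|` fib v| = m ^ k.
  have [_ /(_ v)<-] := fP _ (hcompc v); last exact/hcompP/hlinked_refl.
  rewrite card_hcomps_sum_cond //.
  by apply: saturated_descendants => //; exact: saturated_hcomp.
have card_words : #|{: k.-tuple 'I_m}| = m ^ k by rewrite card_tuple card_ord.
pose phi v (w : k.-tuple 'I_m) := nth [::] (fib v) (enum_rank w).
have rank_lt v (w : k.-tuple 'I_m) : enum_rank w < size (fib v).
  by rewrite card_fib -card_words.
have phiP v w := fibP v (phi v w) (mem_nth [::] (rank_lt v w)).
exists phi; split=> [v w|v w|v v' w w' eqp|l x xl|v w w' /eqP].
- by case: (phiP v w).
- by case: (phiP v w).
- have [sv tv <-] := phiP v w; have [sv' tv' <-] := phiP v' w'.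
  have svv : size v = size v'.
    by apply/eqP; rewrite -(eqn_add2r k) -sv -sv' (hlinked_size eqp).
  rewrite (proj2 (hcomp_eq _ _ _ _) eqp); congr (f _ _); apply/hcomp_eq.
  apply: hlinked_trans tv'; apply: hlinked_trans (hlinked_sym tv) _.
  by rewrite -svv; exact: hlinked_take.
- set T := hcomp (take l x).
  have lx : l <= size x by rewrite xl leq_addr.
  have xD : hcomp x \in hcomps (descendants k T).
    apply/hcompsP; exists x => //; apply/descendantsP; rewrite xl leq_addl addnK.
    by split=> //; exact/hcompP/hlinked_refl.
  have vT : f T (hcomp x) \in T by case: (fP _ (hcompc (take l x))) => h _; exact: h.
  pose v := f T (hcomp x).
  have sv : size v = l by move/hcompP/hlinked_size: vT; rewrite size_takel.
  have xv : x \in fib v.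
    apply/fibP; rewrite sv; split=> //; first exact/hcompP.
    by rewrite -(proj2 (hcomp_eq _ _ _ _) (elimT (hcompP _ _ _ _) vT)).
  have ix : index x (fib v) < #|{: k.-tuple 'I_m}|.
    by rewrite card_words -(card_fib v) index_mem.
  exists v, (enum_val (Ordinal ix)); split=> //.
  by rewrite /phi enum_valK /= nth_index.
- by rewrite nth_uniq ?fset_uniq // => /eqP/val_inj/enum_rank_inj.
Qed.

End Rewiring.

(** * Graphs that are trees up to bounded horizontal walks *)

Local Open Scope ring_scope.

Section Walks.
Variables (V : eqType) (e : rel V).

Lemma walk_cat x y z n k : walk_of_length e x y n -> walk_of_length e y z k ->
  walk_of_length e x z (n + k)%N.
Proof.
move=> [p [xp py <-]] [q [yq qz <-]]; exists (p ++ q); split.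
- by rewrite cat_path xp py.
- by rewrite last_cat py.
- by rewrite size_cat.
Qed.

Lemma graph_distP x y n : walk_of_length e x y n ->
  walk_of_length e x y (graph_dist e x y) /\ (graph_dist e x y <= n)%N.
Proof.
move=> xyn; rewrite /graph_dist.
set P := [set _ | _]; suff /(xgetPex 0%N) : exists k, P k.
  by move=> [walk min]; split=> //; exact: min.
have ex : exists k, `[< walk_of_length e x y k >] by exists n; apply/asboolP.
case: (ex_minnP ex) => k /asboolP xyk min; exists k; split=> // l xyl.
exact/min/asboolP.
Qed.

End Walks.

(** The features shared by the tree [vedge], with equality for [sim], and by the
    augmented tree, with [sim] the membership in a common component and [c] a bound
    on the size of components: collapsing the classes gives a tree, and a class has
    bounded diameter. *)
Record tree_like (m : nat) (e : rel (seq 'I_m))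
    (sim : seq 'I_m -> seq 'I_m -> Prop) (c : nat) : Prop := TreeLike {
  sim_refl : forall u, sim u u;
  sim_sym : forall u v, sim u v -> sim v u;
  sim_trans : forall v u w, sim u v -> sim v w -> sim u w;
  sim_size : forall u v, sim u v -> size u = size v;
  sim_take : forall l u v, sim u v -> sim (take l u) (take l v);
  vedge_edge : subrel (@vedge m) e;
  edge_cases : forall u v, e u v -> vedge u v \/ sim u v;
  sim_walk : forall u v, sim u v ->
    exists2 n, walk_of_length e u v n & (n <= c)%N
}.

Section TreeLike.
Variables (R : realType) (m : nat) (e : rel (seq 'I_m)).
Variables (sim : seq 'I_m -> seq 'I_m -> Prop) (c : nat).
Hypothesis tl : tree_like e sim c.
Local Notation word := (seq 'I_m).
Local Notation dist := (graph_dist e).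
Local Notation gp := (gromov_product R e [::]).

(** The words [x] and [y] lie below the same class of level [l]. *)
Definition agree (l : nat) (x y : word) : Prop :=
  [/\ (l <= size x)%N, (l <= size y)%N & sim (take l x) (take l y)].

Lemma agree_refl l x : (l <= size x)%N -> agree l x x.
Proof. by move=> lx; split=> //; exact: sim_refl tl _. Qed.

Lemma agree_sym l x y : agree l x y -> agree l y x.
Proof. by case=> lx ly xy; split=> //; exact: sim_sym tl _ _ xy. Qed.

Lemma agree_trans l y x z : agree l x y -> agree l y z -> agree l x z.
Proof. by case=> lx _ xy [_ lz yz]; split=> //; exact: sim_trans tl _ _ _ xy yz. Qed.

Lemma agree_le l j x y : (j <= l)%N -> agree l x y -> agree j x y.
Proof.
move=> jl [lx ly xy]; split; [exact: leq_trans lx|exact: leq_trans ly|].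
by rewrite -(take_takel x jl) -(take_takel y jl); exact: sim_take tl _ _ _ xy.
Qed.

Lemma walk_down u w : walk_of_length e u (u ++ w) (size w).
Proof.
elim: w u => [|i w IHw] u; first by exists [::]; rewrite cats0.
rewrite -cat_rcons [size _]/= -add1n; apply: walk_cat (IHw _).
exists [:: rcons u i]; rewrite /= andbT; split=> //; apply: vedge_edge tl _ _ _.
by apply/existsP; exists i; rewrite eqxx.
Qed.

Lemma walk_up u w : walk_of_length e (u ++ w) u (size w).
Proof.
elim: w u => [|i w IHw] u; first by exists [::]; rewrite cats0.
rewrite -cat_rcons [size _]/= -addn1; apply: walk_cat (IHw _) _.
exists [:: u]; rewrite /= andbT; split=> //; apply: vedge_edge tl _ _ _.
by apply/existsP; exists i; rewrite eqxx orbT.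
Qed.

Lemma walk_of_agree l x y : agree l x y -> exists2 n,
  walk_of_length e x y n & (n + 2 * l <= size x + size y + c)%N.
Proof.
case=> lx ly /(sim_walk tl)[n xyn nc].
have := walk_up (take l x) (drop l x); rewrite cat_take_drop size_drop => xup.
have := walk_down (take l y) (drop l y); rewrite cat_take_drop size_drop => ydown.
exists (size x - l + (n + (size y - l)))%N; first exact: walk_cat xup (walk_cat xyn ydown).
by lia.
Qed.

(** A walk moves between the subtrees hanging below two classes only through
    these classes.  The endpoints therefore agree on the lowest level that the walk
    visits, and climbing from there to the endpoints takes one step per level. *)
Lemma agree_of_path (p : seq word) (x y : word) : path e x p -> last x p = y ->
  exists2 j, agree j x y & (size x + size y <= size p + 2 * j)%N.
Proof.
elim: p x => [|z p IHp] x /=.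
  move=> _ ->; exists (size y); first exact: agree_refl.
  by rewrite add0n mul2n addnn.
case/andP=> xz zp py; have [j zy jle] := IHp z zp py.
have [jz jy zyj] := zy.
case: (edge_cases tl xz) => [/existsP[i /orP[/eqP zE|/eqP xE]]|xz_sim].
- have sz : size z = (size x).+1 by rewrite zE size_rcons.
  have take_zx l : (l <= size x)%N -> take l z = take l x.
    by move=> lx; rewrite zE -cats1 takel_cat.
  have [jx|xj] := leqP j (size x).
    by exists j; [split; rewrite -?take_zx|lia].
  (* Here [j] is the level of [z], which [x] does not reach. *)
  exists (size x); last by lia.
  have [|_ ? ?] := @agree_le j (size x) _ _ _ zy; first by lia.
  by split; rewrite -?take_zx.
- have sx : size x = (size z).+1 by rewrite xE size_rcons.
  exists j; last by lia.
  by split=> //; [lia|rewrite xE -cats1 takel_cat].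
- have sx := sim_size tl xz_sim; exists j; last by lia.
  split; rewrite ?sx //; apply: (sim_trans tl) zyj.
  exact: sim_take tl _ _ _ xz_sim.
Qed.

Lemma agree_of_walk n (x y : word) : walk_of_length e x y n -> exists2 j,
  agree j x y & (size x + size y <= n + 2 * j)%N.
Proof. by move=> [p [xp py <-]]; exact: agree_of_path. Qed.

Lemma dist_root (x : word) : dist [::] x = size x.
Proof.
have [walk le] := graph_distP (walk_down [::] x).
apply/eqP; rewrite eqn_leq le /=.
by have [j [j0 _ _]] := agree_of_walk walk; rewrite /= in j0 *; lia.
Qed.

(** This lemma and the next identify the Gromov product, up to [c], with the last
    level of agreement, as in a tree. *)
Lemma gromov_product_ge l x y : agree l x y -> l%:R - c%:R <= gp x y.
Proof.
move=> /walk_of_agree[n /graph_distP[_ le] nle].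
rewrite /gromov_product !dist_root ler_pdivlMr // mulrBl lerBlDr addrAC lerBrDr.
rewrite -natrD -!natrM -!natrD ler_nat; move: (dist _ _) le => k le; lia.
Qed.

Lemma agree_of_gromov_product l x y : l%:R <= gp x y -> agree l x y.
Proof.
rewrite /gromov_product !dist_root ler_pdivlMr // lerBrDr.
rewrite -natrD -natrM -natrD ler_nat.
have [|n xyn _] := @walk_of_agree 0 x y.
  by split=> //; rewrite !take0; exact: sim_refl tl _.
have [/agree_of_walk[j xyj jle] _] := graph_distP xyn.
by move=> le; apply: agree_le xyj; lia.
Qed.

End TreeLike.

(** * The boundary of a rewired tree *)

Lemma limn_sup_between (R : realType) (u : nat -> R) (M lo hi : R) :
  (forall n, 0 <= u n <= M) -> (\forall n \near \oo, lo <= u n <= hi) ->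
  lo <= limn_sup u <= hi.
Proof.
move=> u0M [N _ uN].
have ubd k : ubound (sdrop u k) M.
  by move=> _ [n _ <-]; case/andP: (u0M n).
have drop0 k : sdrop u k !=set0 by exists (u k), k => /=.
have bu : bounded_fun u.
  exists M; split; first exact: num_real.
  move=> x Mx n _; have /andP[u0 uM] := u0M n.
  by rewrite /= ger0_norm // (le_trans uM) // ltW.
have sup_ge k : lo <= sups u k.
  have /andP[lo_u _] := uN (maxn N k) (leq_maxl _ _).
  apply: le_trans lo_u _; apply: ub_le_sup; first by exists M; exact: ubd.
  by exists (maxn N k) => //=; exact: leq_maxr.
rewrite limn_supE //; apply/andP; split.
  apply: lb_le_inf; first by exists (sups u 0), 0%N.
  by move=> _ [k _ <-]; exact: sup_ge.
apply: (@le_trans _ _ (sups u N)).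
  apply: ge_inf; last by exists N.
  by exists lo => _ [k _ <-]; exact: sup_ge.
apply: ge_sup => // _ [n Nn <-].
by have /andP[] := uN n Nn.
Qed.

Section Boundary.
Variables (R : realType) (m : nat) (e : rel (seq 'I_m)).
Variables (sim : seq 'I_m -> seq 'I_m -> Prop) (c : nat).
Hypothesis tl : tree_like e sim c.
Variable a : R.
Hypothesis a_gt0 : 0 < a.
Local Notation word := (seq 'I_m).
Local Notation agree := (agree sim).
Local Notation rho := (rho e [::] a).
Local Notation rho_cauchy := (rho_cauchy e [::] a).
Local Notation cauchy_class := (cauchy_class e [::] a).

(** The order of magnitude of [rho] for words that separate at level [l]. *)
Definition scale (l : nat) : R := expR (- a * l%:R).

Local Notation K := (expR (a * c%:R)).

Lemma scale_gt0 l : 0 < scale l.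
Proof. exact: expR_gt0. Qed.

Lemma scale_small (eps : R) : 0 < eps -> exists l, scale l * K < eps.
Proof.
move=> eps0; pose l := Num.truncn (K / (eps * a)); exists l.+1.
rewrite /scale mulNr expRN [_ * K]mulrC ltr_pdivrMr ?expR_gt0 // [eps * _]mulrC.
rewrite -ltr_pdivrMr // (lt_le_trans _ (expR_ge1Dx _)) //.
have lt_l : K / (eps * a) < l.+1%:R.
  by rewrite truncnS_gt.
rewrite (@lt_trans _ _ (a * l.+1%:R)) ?ltrDr //.
by rewrite -ltr_pdivrMl // mulrC -mulrA -invfM.
Qed.

Lemma rho_ge0 x y : 0 <= rho x y.
Proof. by rewrite /rho; case: eqP => // _; exact: expR_ge0. Qed.

Lemma rho_refl x : rho x x = 0.
Proof. by rewrite /rho eqxx. Qed.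

Lemma rho_le_of_agree l x y : agree l x y -> rho x y <= scale l * K.
Proof.
move=> xy; rewrite /rho; case: eqP => _; first by rewrite mulr_ge0 ?expR_ge0.
rewrite /scale -expRD ler_expR.
rewrite (_ : _ + _ = - a * (l%:R - c%:R)); last by ring.
by rewrite !mulNr lerN2 ler_pM2l // (gromov_product_ge R tl).
Qed.

Lemma rho_le x y : rho x y <= K.
Proof.
have xy : agree 0 x y by split=> //; rewrite !take0; exact: sim_refl tl _.
by have := rho_le_of_agree xy; rewrite /scale mulr0 expR0 mul1r.
Qed.

Lemma rho_ge_of_not_agree l x y : x != y -> ~ agree l x y -> scale l <= rho x y.
Proof.
move=> xy nag; rewrite /rho (negPf xy) /scale ler_expR !mulNr lerN2 ler_pM2l //.
by rewrite leNgt; apply/negP => /ltW/(agree_of_gromov_product tl).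
Qed.

Lemma agree_of_rho_lt l x y : rho x y < scale l -> x = y \/ agree l x y.
Proof.
move=> xyl; case: (eqVneq x y) => [|xy]; first by left.
right; apply: contrapT => /(rho_ge_of_not_agree xy).
by rewrite leNgt xyl.
Qed.

(** Sequences that share an end: they agree up to any given level from some
    moment on.  In particular [close x x] says that [x] leaves every level. *)
Definition close (x y : nat -> word) : Prop :=
  forall l, \forall n \near \oo, agree l (x n) (y n).

Lemma close_sym x y : close x y -> close y x.
Proof. by move=> xy l; apply: filterS (xy l) => n; exact: (agree_sym tl). Qed.

Lemma close_trans y x z : close x y -> close y z -> close x z.
Proof.
move=> xy yz l; apply: filterS2 (xy l) (yz l) => n.
exact: (agree_trans tl).
Qed.

Lemma close_left x y : close x y -> close x x.
Proof. by move=> xy; apply: close_trans xy (close_sym xy). Qed.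

Lemma rho_cvg0_of_close x y :
  close x y -> rho (x n) (y n) @[n --> \oo] --> (0 : R).
Proof.
move=> xy; apply/cvgr0Pnorm_lt => eps eps0.
have [l le] := scale_small eps0.
apply: filterS (xy l) => n /rho_le_of_agree xyn.
by rewrite ger0_norm ?rho_ge0 //; exact: le_lt_trans le.
Qed.

Lemma close_of_rho_cvg0 x y : close x x ->
  rho (x n) (y n) @[n --> \oo] --> (0 : R) -> close x y.
Proof.
move=> xx /cvgr0Pnorm_lt xy l.
apply: filterS2 (xx l) (xy _ (scale_gt0 l)) => n [lx _ _].
rewrite ger0_norm ?rho_ge0 // => /agree_of_rho_lt[<-|//].
exact: (agree_refl tl).
Qed.

Lemma cauchy_class_close x : close x x ->
  cauchy_class x = [set y | rho_cauchy y /\ close x y].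
Proof.
move=> xx; apply/seteqP; split=> y [yc xy]; split=> //.
  exact: close_of_rho_cvg0.
exact: rho_cvg0_of_close.
Qed.

Lemma cauchy_class_self x : rho_cauchy x -> cauchy_class x x.
Proof. by move=> xc; split=> //; under eq_fun do rewrite rho_refl; exact: cvg_cst. Qed.

Lemma cauchy_class_eventually_const x v :
  (\forall n \near \oo, x n = v) -> cauchy_class x = cauchy_class (fun=> v).
Proof.
move=> xv; apply/seteqP; split=> y [yc xy]; (split; first exact: yc);
  apply: cvg_trans xy; apply: near_eq_cvg; apply: filterS xv => n ->; exact: erefl.
Qed.

(** Unless the sequence stalls, each of its terms differs from a later one; as
    these two are close for [rho], the term itself must lie deep in the tree. *)
Lemma cauchy_dichotomy x : rho_cauchy x ->
  (exists v, \forall n \near \oo, x n = v) \/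
  forall l, exists N, forall n k, (N <= n)%N -> (N <= k)%N -> agree l (x n) (x k).
Proof.
move=> xc; have [|nconst] := pselect (exists v, \forall n \near \oo, x n = v).
  by left.
right=> l; have [N xN] := xc _ (scale_gt0 l); exists N => n k Nn Nk.
case: (agree_of_rho_lt (xN n k Nn Nk)) => // <-.
have [n' Nn' xn'] : exists2 n', (N <= n')%N & x n' <> x n.
  apply: contrapT => noex; apply: nconst; exists (x n), N => // n' /= Nn'.
  by apply: contrapT => xn'; apply: noex; exists n'.
have [xnn'|[lx _ _]] := agree_of_rho_lt (xN n n' Nn Nn').
  by case: xn'.
exact: (agree_refl tl).
Qed.

Lemma rho_cauchy_of_agree x :
  (forall l, exists N, forall n k, (N <= n)%N -> (N <= k)%N -> agree l (x n) (x k)) ->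
  rho_cauchy x.
Proof.
move=> xx eps /scale_small[l le]; have [N xN] := xx l.
exists N => n k Nn Nk; apply: le_lt_trans le.
exact/rho_le_of_agree/xN.
Qed.

Variables (k : nat) (phi : word -> k.-tuple 'I_m -> word).
Hypothesis k_gt0 : (0 < k)%N.
Hypothesis phi_rewiring : rewiring sim phi.

(** The branch of the rewired tree coded by the blocks [w]. *)
Fixpoint ray (w : nat -> k.-tuple 'I_m) (n : nat) : word :=
  if n is n'.+1 then phi (ray w n') (w n') else [::].

Local Notation end_of w := (cauchy_class (ray w)).

Lemma size_ray w n : size (ray w n) = (n * k)%N.
Proof.
have [size_phi _ _ _ _] := phi_rewiring.
by elim: n => //= n IHn; rewrite size_phi IHn mulSn addnC.
Qed.

(** A ray of the rewired tree need not be a ray of the given tree, but its classes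
    do form a branch of the collapsed tree. *)
Lemma ray_take w j n : (j <= n)%N -> sim (take (j * k) (ray w n)) (ray w j).
Proof.
have [_ take_phi _ _ _] := phi_rewiring.
move=> /subnKC <-; elim: (n - j)%N => [|i IHi].
  by rewrite addn0 take_oversize ?size_ray //; exact: sim_refl tl _.
rewrite addnS /=; apply: (sim_trans tl) IHi.
have := sim_take tl (j * k) (take_phi (ray w (j + i)) (w (j + i)%N)).
by rewrite size_ray take_takel // leq_mul2r leq_addr orbT.
Qed.

Lemma ray_agree w l n n' : (l <= n)%N -> (l <= n')%N ->
  agree l (ray w n) (ray w n').
Proof.
move=> ln ln'; apply: (agree_le tl (leq_pmulr l k_gt0)).
split; rewrite ?size_ray ?leq_mul2r ?ln ?ln' ?orbT //.
apply: (sim_trans tl) (ray_take w ln) _.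
exact: (sim_sym tl (ray_take w ln')).
Qed.

Lemma ray_cauchy w : rho_cauchy (ray w).
Proof. by apply: rho_cauchy_of_agree => l; exists l => n n'; exact: ray_agree. Qed.

Lemma ray_close w : close (ray w) (ray w).
Proof. by move=> l; exists l => // n ln; exact: ray_agree. Qed.

Lemma end_ofP w y : end_of w y <-> rho_cauchy y /\ close (ray w) y.
Proof. by rewrite cauchy_class_close //; exact: ray_close. Qed.

(** A ray leaves every level, hence it does not converge to a vertex. *)
Lemma end_boundary w : hyp_boundary e [::] a (end_of w).
Proof.
split; first by exists (ray w) => //; exact: ray_cauchy.
move=> [v _ vw].
have : cauchy_class (fun=> v) (ray w) by rewrite vw; exact/cauchy_class_self/ray_cauchy.
case=> _ /cvgr0Pnorm_lt /(_ _ (scale_gt0 (size v).+1))[N _ vN].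
pose n := maxn N (size v).+1.
have := vN n (leq_maxl _ _); rewrite [rho_n in `|rho_n|]/= ger0_norm; last exact: rho_ge0.
case/agree_of_rho_lt => [/(congr1 size)|[]]; last by rewrite ltnn.
rewrite size_ray => sv; have : ((size v).+1 <= n * k)%N.
  by apply: leq_trans (leq_pmulr _ k_gt0); exact: leq_maxr.
by rewrite -sv ltnn.
Qed.

(** Every boundary point is the end of a ray: the prefixes of a representing
    sequence form a chain of classes, and each class of the chain singles out the
    word of the previous level that the rewiring makes its parent. *)
Lemma end_of_surj xi : hyp_boundary e [::] a xi -> exists w, xi = end_of w.
Proof.
have [size_phi take_phi parent phi_surj _] := phi_rewiring.
case=> [[x xc <-] nbase].
have [[v xv]|xx] := cauchy_dichotomy xc.
  case: nbase; exists v; first exact: I.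
  exact/esym/cauchy_class_eventually_const.
have [N NP] := choice (fun j => xx (j * k)%N).
(* The classes of the [v j] form the branch followed by [x]. *)
pose v j := take (j * k) (x (N j)).
have vP j n : (N j <= n)%N -> sim (v j) (take (j * k) (x n)).
  by move=> Nn; have [_ _] := NP j (N j) n (leqnn _) Nn.
have size_v j : size (v j) = (j * k)%N.
  by have [jx _ _] := NP j (N j) (N j) (leqnn _) (leqnn _); rewrite size_takel.
have v_chain j : sim (take (j * k) (v j.+1)) (v j).
  pose n := maxn (N j) (N j.+1).
  apply: (sim_trans tl) (sim_sym tl (vP j n (leq_maxl _ _))).
  have := sim_take tl (j * k) (vP j.+1 n (leq_maxr _ _)).
  by rewrite (take_takel (x n)) // leq_mul2r leqnSn orbT.
(* [u j] is the new parent of [v j.+1]. *)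
have [u uP] : {u | forall j, size (u j) = (j * k)%N /\ exists w, v j.+1 = phi (u j) w}.
  have ex j : exists u, size u = (j * k)%N /\ exists w, v j.+1 = phi u w.
    have [|u [w [su vE]]] := phi_surj (j * k)%N (v j.+1).
      by rewrite size_v mulSn addnC.
    by exists u; split=> //; exists w.
  by have [u uP] := choice ex; exists u.
have u_sim j : sim (u j) (v j).
  have [su [w vE]] := uP j; apply: (sim_trans tl) (v_chain j).
  by apply: (sim_sym tl); rewrite vE -{1}su; exact: take_phi.
(* [u j.+1] and [v j.+1] are in one class, so they share the new parent [u j]. *)
have [w wP] : {w | forall j, u j.+1 = phi (u j) (w j)}.
  have ex j : exists w, u j.+1 = phi (u j) w.
    have [su1 _] := uP j.+1; have [_ [w' vE]] := uP j.
    have [|u' [w [_ uE]]] := phi_surj (j * k)%N (u j.+1).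
      by rewrite su1 mulSn addnC.
    have := u_sim j.+1; rewrite uE vE => /parent uu'.
    by exists w; rewrite -uu'.
  by have [w wP] := choice ex; exists w.
have ray_u j : ray w j = u j.
  elim: j => [|j IHj] /=; last by rewrite IHj -wP.
  by have [/size0nil] := uP 0%N.
exists w; have xw : close (ray w) x.
  move=> l; exists (maxn (N l) l) => // n /=; rewrite geq_max => /andP[Nn ln].
  apply: (agree_le tl (leq_pmulr l k_gt0)).
  have [_ lx _] := NP l (N l) n (leqnn _) Nn.
  split=> //; first by rewrite size_ray leq_mul2r ln orbT.
  apply: (sim_trans tl) (vP l n Nn); apply: (sim_trans tl) (u_sim l).
  by rewrite -ray_u; exact: ray_take.
rewrite !cauchy_class_close; [|exact: ray_close|exact: close_left (close_sym xw)].
apply/seteqP; split=> y [yc xy]; split=> //; first exact: close_trans xw xy.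
exact: close_trans (close_sym xw) xy.
Qed.

Section FirstDifference.
Variables (w w' : nat -> k.-tuple 'I_m) (N : nat).
Hypothesis eq_before : forall i, (i < N)%N -> w i = w' i.
Hypothesis neq_at : w N <> w' N.

Lemma ray_eq n : (n <= N)%N -> ray w n = ray w' n.
Proof.
by elim: n => //= n IHn nN; rewrite IHn ?eq_before //; exact: ltnW.
Qed.

(** The words of the two rays on level [N + 1] are distinct but may lie in the
    same class; their offspring cannot. *)
Lemma ray_not_sim : ~ sim (ray w N.+2) (ray w' N.+2).
Proof.
have [_ _ parent _ inj] := phi_rewiring.
rewrite [ray w _]/= [ray w' _]/= => /parent; rewrite -(ray_eq (leqnn N)).
by move=> /inj/neq_at.
Qed.

Lemma close_ray_between (y y' : nat -> word) :
  close (ray w) y -> close (ray w') y' ->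
  \forall n \near \oo, scale (N.+2 * k) <= rho (y n) (y' n) <= scale (N * k) * K.
Proof.
move=> wy wy'; pose l := (N.+2 * k)%N; pose j := (N * k)%N.
near=> n.
have Nn : (N.+2 <= n)%N by near: n; exact: nbhs_infty_ge.
have jl : (j <= l)%N by rewrite /j /l leq_mul2r -addn2 leq_addr orbT.
have y_ray : agree l (ray w n) (y n) by near: n; exact: wy.
have y'_ray : agree l (ray w' n) (y' n) by near: n; exact: wy'.
have nag : ~ agree l (y n) (y' n).
  move=> yy'; apply: ray_not_sim.
  apply: (sim_trans tl) (ray_take w' Nn).
  apply: (sim_trans tl) (sim_sym tl (ray_take w Nn)) _.
  have [_ _] := agree_trans tl y_ray (agree_trans tl yy' (agree_sym tl y'_ray)).
  by [].
apply/andP; split.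
  apply: (rho_ge_of_not_agree _ nag); apply/eqP => yy'; apply: nag.
  by rewrite yy'; case: y'_ray => _ ly' _; exact: agree_refl tl _ _ ly'.
apply: rho_le_of_agree; have N_n : (N <= n)%N by apply: leq_trans Nn; rewrite -addn2 leq_addr.
apply: (agree_trans tl) (agree_sym tl (agree_le tl jl y_ray)) _.
apply: (agree_trans tl) (agree_le tl jl y'_ray).
split; rewrite ?size_ray ?leq_mul2r ?N_n ?orbT //.
apply: (sim_trans tl) (ray_take w N_n) _.
by rewrite (ray_eq (leqnn N)); exact: (sim_sym tl (ray_take w' N_n)).
Unshelve. all: by end_near. Qed.

(** Codes that differ first at [N] have ends that separate between the levels
    [N * k] and [N.+2 * k], whatever the representing sequences. *)
Lemma rho_ext_between :
  scale (N.+2 * k) <= rho_ext e [::] a (end_of w) (end_of w') <= scale (N * k) * K.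
Proof.
rewrite /rho_ext; set D := image2 _ _ _.
have Dbetween z : D z -> scale (N.+2 * k) <= z <= scale (N * k) * K.
  move=> [y /end_ofP[_ wy] [y' /end_ofP[_ wy'] <-]].
  apply: (@limn_sup_between _ _ K); last exact: close_ray_between.
  by move=> n; rewrite rho_ge0 rho_le.
have D0 : D (limn_sup (fun n => rho (ray w n) (ray w' n))).
  by exists (ray w); [exact/cauchy_class_self/ray_cauchy|
    exists (ray w') => //; exact/cauchy_class_self/ray_cauchy].
have /andP[lo hi] := Dbetween _ D0; apply/andP; split.
  apply: le_trans lo _; apply: ub_le_sup => //.
  by exists (scale (N * k) * K) => z /Dbetween/andP[].
by apply: ge_sup; [eexists; exact: D0|move=> z /Dbetween/andP[]].
Qed.

Lemma end_of_neq : end_of w <> end_of w'.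
Proof.
move=> ww'; have /end_ofP[_ w'w] : end_of w' (ray w).
  by rewrite -ww'; exact/cauchy_class_self/ray_cauchy.
have [n _ /(_ n (leqnn n))/andP[lo _]] :=
  close_ray_between (ray_close w) w'w.
by move: lo; rewrite rho_refl leNgt scale_gt0.
Qed.

End FirstDifference.

Lemma rho_ext_refl w : rho_ext e [::] a (end_of w) (end_of w) = 0.
Proof.
rewrite /rho_ext; set D := image2 _ _ _; suff -> : D = [set 0] by rewrite sup1.
have wD : end_of w (ray w) by exact/cauchy_class_self/ray_cauchy.
have D0 z : D z -> z = 0.
  move=> [y /end_ofP[_ wy] [y' /end_ofP[_ wy'] <-]].
  have /cvg_limn_inf_sup[_ ->//] := rho_cvg0_of_close (close_trans (close_sym wy) wy').
apply/seteqP; split=> [z /D0 //|_ ->].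
rewrite -[X in D X](D0 (limn_sup (fun n => rho (ray w n) (ray w n)))).
  by exists (ray w) => //; exists (ray w).
by exists (ray w) => //; exists (ray w).
Qed.

End Boundary.

(** * Lipschitz equivalence of the two boundaries *)

(** Both boundaries are coded by the same sequences of blocks of length [k].  Two
    codes that differ first at [N] give ends at distance comparable with
    [scale a (N * k)] in either boundary, because the scales of the levels [N * k]
    and [N.+2 * k] have the ratio [D], which does not depend on [N]. *)
Lemma lipschitz_of_rewirings (R : realType) (m k : nat) (a : R)
    (e1 e2 : rel (seq 'I_m)) (sim1 sim2 : seq 'I_m -> seq 'I_m -> Prop)
    (c1 c2 : nat) (phi1 phi2 : seq 'I_m -> k.-tuple 'I_m -> seq 'I_m) :
  0 < a -> (0 < k)%N ->
  tree_like e1 sim1 c1 -> tree_like e2 sim2 c2 ->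
  rewiring sim1 phi1 -> rewiring sim2 phi2 ->
  lipschitz_equivalent (hyp_boundary e1 [::] a) (rho_ext e1 [::] a)
                       (hyp_boundary e2 [::] a) (rho_ext e2 [::] a).
Proof.
move=> a0 k0 tl1 tl2 rw1 rw2.
pose end1 w := cauchy_class e1 [::] a (ray phi1 w).
pose end2 w := cauchy_class e2 [::] a (ray phi2 w).
have first_diff (w w' : nat -> k.-tuple 'I_m) : w <> w' ->
    exists2 N, (forall i, (i < N)%N -> w i = w' i) & w N <> w' N.
  move=> ww'; have ex : exists n, w n != w' n.
    apply: contrapT => noex; apply: ww'; apply: funext => n.
    by apply: contrapT => /eqP wn; apply: noex; exists n.
  case: (ex_minnP ex) => N /eqP neqN minN; exists N => // i iN.
  by apply: contrapT => /eqP /minN; rewrite leqNgt iN.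
have inj1 w w' : end1 w = end1 w' -> w = w'.
  move=> eq_end; apply: contrapT => /first_diff[N before at_N].
  exact: (end_of_neq tl1 a0 k0 rw1 before at_N).
have inj2 w w' : end2 w = end2 w' -> w = w'.
  move=> eq_end; apply: contrapT => /first_diff[N before at_N].
  exact: (end_of_neq tl2 a0 k0 rw2 before at_N).
have surj1 xi : hyp_boundary e1 [::] a xi -> exists w, xi = end1 w.
  exact: (end_of_surj tl1 a0 k0 rw1).
have surj2 xi : hyp_boundary e2 [::] a xi -> exists w, xi = end2 w.
  exact: (end_of_surj tl2 a0 k0 rw2).
pose sigma xi := xget set0 [set eta | exists2 w, xi = end1 w & eta = end2 w].
have sigmaE w : sigma (end1 w) = end2 w.
  rewrite /sigma; case: xgetP => [_ _ [w' /inj1 -> //]|/(_ (end2 w)) []].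
  by exists w.
clearbody sigma; exists sigma; split.
  split=> [xi /surj1[w ->]|xi eta|eta /surj2[w ->]].
  - by rewrite sigmaE; exact: (end_boundary tl2 a0 k0 rw2).
  - rewrite !inE => /surj1[w ->].
    move=> /surj1[w' ->].
    by rewrite (sigmaE w) (sigmaE w') => /inj2 ->.
  - by exists (end1 w); [exact: (end_boundary tl1 a0 k0 rw1)|exact: sigmaE].
pose D := expR (a * (2 * k)%:R).
pose K1 := expR (a * c1%:R); pose K2 := expR (a * c2%:R).
have scaleE N : scale a (N * k) = D * scale a (N.+2 * k).
  rewrite /scale /D -expRD !natrM; congr expR.
  by rewrite -addn2 natrD; ring.
have ge1 c : 1 <= expR (a * c%:R).
  by rewrite -expR0 ler_expR mulr_ge0 // ltW.
have dominated s u v K K' : 1 <= K' -> s <= u -> v <= D * s * K ->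
    0 <= s -> 0 <= K -> v <= D * (K * K') * u.
  move=> K'1 su vs s0 K0; apply: le_trans vs _.
  have D0 : 0 <= D by exact: expR_ge0.
  rewrite -!mulrA ler_wpM2l // mulrC ler_wpM2l //.
  by rewrite (le_trans su) // ler_peMl // (le_trans s0).
have C0 : 0 < D * (K1 * K2) by rewrite !mulr_gt0 ?expR_gt0.
exists (D * (K1 * K2)); split=> // xi eta /surj1[w ->].
move=> /surj1[w' ->].
rewrite (sigmaE w) (sigmaE w') ler_pdivrMl //.
have [<-|/first_diff[N before at_N]] := pselect (w = w').
  rewrite (rho_ext_refl tl1 a0 k0 rw1) (rho_ext_refl tl2 a0 k0 rw2).
  by rewrite mulr0 lexx.
have /andP[lo1 hi1] := rho_ext_between tl1 a0 k0 rw1 before at_N.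
have /andP[lo2 hi2] := rho_ext_between tl2 a0 k0 rw2 before at_N.
rewrite scaleE in hi1 hi2; apply/andP; split.
  exact: dominated (ge1 c2) lo2 hi1 (ltW (scale_gt0 _ _)) (expR_ge0 _).
rewrite [K1 * _]mulrC.
exact: dominated (ge1 c1) lo1 hi2 (ltW (scale_gt0 _ _)) (expR_ge0 _).
Qed.

Lemma tree_like_vedge (m : nat) : tree_like (@vedge m) eq 0.
Proof.
split=> [//|u v -> //|v u w -> //|u v -> //|l u v -> //|//|u v uv|u v ->].
  by left.
by exists 0%N => //; exists [::].
Qed.

Lemma tree_like_aug_edge (m : nat) (E : Type) (S : 'I_m -> E -> E) (J : set E)
    (c : nat) :
  (forall i, S i @` J `<=` J) -> (forall u, #|` hcomp S J u| <= c)%N ->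
  tree_like (aug_edge S J) (hlinked S J) c.
Proof.
move=> SJ hcompc; split.
- exact: hlinked_refl.
- exact: hlinked_sym.
- exact: hlinked_trans.
- exact: hlinked_size.
- exact: hlinked_take.
- by move=> u v uv; apply/orP; left.
- by move=> u v /orP[|/hlinked_hedge]; [left|right].
move=> u v [p [up <-]]; case: (shortenP up) => q uq uniq_q _.
exists (size q); first by exists q; split=> //; apply: sub_path uq => x y xy; apply/orP; right.
apply: leq_trans (hcompc u); have /andP[_ uniq_q'] := uniq_q.
apply: uniq_leq_size => // x xq; apply/hcompP.
by case/splitPr: xq uq => q1 q2; rewrite cat_path /= => /and3P[h1 h2 _];
  exists (rcons q1 x); rewrite rcons_path h1 h2 last_rcons.
Qed.

Theorem theorem3p8 (R : realType) (d m : nat) (r : R)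
    (Q : 'I_m -> 'M[R]_d) (t : 'I_m -> 'cV[R]_d) (J : set 'cV[R]_d)
    (kappa : nat) (cls : 'I_kappa -> set {fset seq 'I_m})
    (A : 'M[nat]_kappa) (b : 'cV[nat]_kappa) :
  let S := fun i : 'I_m => similitude r (Q i) (t i) in
  0 < r < 1 ->
  (forall i, Q i *m (Q i)^T = 1%:M) ->
  J !=set0 -> bounded_set J -> closed J ->
  (forall i, S i @` J `<=` J) ->
  simple_tree S J ->
  enumerates_classes S J cls ->
  is_incidence_matrix S J cls A ->
  is_size_vector S J cls b ->
  primitive A ->
  (exists k : nat, (0 < k)%N /\ rearrangeable (m ^ k)%N b (A ^+ k)) /\
  (forall delta a : R,
     0 < delta -> hyperbolic_with (aug_edge S J) [::] delta ->
     0 < a -> expR (delta * a) - 1 < Num.sqrt 2 - 1 ->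
     lipschitz_equivalent
       (hyp_boundary (aug_edge S J) [::] a) (rho_ext (aug_edge S J) [::] a)
       (hyp_boundary (@vedge m) [::] a) (rho_ext (@vedge m) [::] a)).
Proof.
move=> S _ _ _ _ _ SJ _ clsE AE bE primA.
have [j0 [bj0 [k [k0 Ak]]]] := abundant_singletons SJ clsE AE bE primA.
have fair := fair_share_of_singletons SJ clsE AE bE bj0 Ak.
split; first by exists k; split=> //; exact: (rearrangeable_of_fair_share SJ clsE AE bE fair).
move=> delta a _ _ a0 _.
have [phi phi_rw] := rewiring_of_fair_share SJ fair.
apply: lipschitz_of_rewirings a0 k0 _ (tree_like_vedge m) phi_rw (rewiring_cat m k).
apply: tree_like_aug_edge (max_size b) SJ _ => u.
by apply: (card_hcomponent_le_max clsE bE); apply/hcomponentP; exists u.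
Qed.
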